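(* Let $P$ be a nonempty set of propositional letters and $R$ a nonempty set of reason symbols. For every formula $\varphi$ of the language $F$ (defined below), $\varphi$ is derivable in the theory $\mathsf{RBB}$ if and only if $\varphi$ is valid (true at every world of every model).
   Context: Language: $P$ and $R$ are nonempty sets (not necessarily disjoint; a symbol may be both a propositional letter and a reason). The set $F$ of formulas is given by the grammar $\varphi ::= p \mid \neg\varphi \mid (\varphi\lor\varphi) \mid (r:\varphi) \mid r \mid B\varphi$ with $p\in P$, $r\in R$; other Boolean connectives are abbreviations. Intended readings: $r:\varphi$ ''$r$ is a reason to believe $\varphi$'', the formula $r$ ''$r$ is an adequate reason'', $B\varphi$ ''the agent believes $\varphi$''. The theory $\mathsf{RBB}$ has axiom schemes: (CL) all instances of classical propositional tautology schemes; (RK) $r:(\varphi\to\psi)\to(r:\varphi\to r:\psi)$; (A) $r:\varphi\to(r\to\varphi)$; (RB) $r:\varphi\to(Br\to B\varphi)$; (D) $B\varphi\to\neg B\neg\varphi$; and rules: (MP) from $\varphi\to\psi$ and $\varphi$ infer $\psi$; (RN) from $\varphi$ infer $r:\varphi$ (any $r\in R$); (E) from $\varphi\leftrightarrow\psi$ infer $B\varphi\leftrightarrow B\psi$. Models: $M=(W,[\cdot],N,V)$ with $W$ a nonempty set, $[\cdot]$ assigning to each $r\in R$ a relation $[r]\subseteq W\times W$, $N:W\to\wp(\wp(W))$, $V:W\to\wp(P)$. Write $r(w)=\{v\in W:(w,v)\in[r]\}$ and $r^\circ=\{v\in W:(v,v)\in[r]\}$. Models must satisfy: (pr) for each $x\in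 P\cap R$ and $w\in W$, $x\in V(w)$ iff $w\in x(w)$; (d) for all $w$, $X\in N(w)$ implies $W-X\notin N(w)$; (rb) for all $w$, $r$, $X\subseteq W$: if $r(w)\subseteq X$ and $r^\circ\in N(w)$ then $X\in N(w)$. Satisfaction: $M,w\models p$ iff $p\in V(w)$; Boolean clauses as usual; $M,w\models r:\varphi$ iff $r(w)\subseteq [\![\varphi]\!]_M$ where $[\![\varphi]\!]_M=\{v\in W: M,v\models\varphi\}$; $M,w\models r$ iff $w\in r(w)$; $M,w\models B\varphi$ iff $[\![\varphi]\!]_M\in N(w)$. $\varphi$ is valid iff $[\![\varphi]\!]_M=W$ for every model $M$. *)

(* Defs.v *)
From mathcomp Require Import all_boot.
From mathcomp Require Import boolp classical_sets.

Set Implicit Arguments.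
Unset Strict Implicit.
Unset Printing Implicit Defensive.

Local Open Scope classical_set_scope.

(* [P] and [R] are sets over a common type of symbols, so that they may
   overlap.  A symbol of [P `&` R] yields a single atomic formula, whether it
   is read as a propositional letter or as a reason; hence one constructor
   [Atom] for the two grammar clauses "p" and "r". *)
Inductive form (Sym : Type) (P R : set Sym) : Type :=
| Atom of (P `|` R : set Sym)
| Neg of form P R
| Or of form P R & form P R
| Rea of R & form P R
| Bel of form P R.

Section Syntax.
Context {Sym : Type} {P R : set Sym}.
Implicit Types (p : P) (r : R) (phi psi : form P R).

Lemma letter_in p : val p \in P `|` R.
Proof. by apply/mem_set; left; apply/set_mem; exact: (valP p). Qed.

Lemma reason_in r : val r \in P `|` R.
Proof. by apply/mem_set; right; apply/set_mem; exact: (valP r). Qed.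

Definition Letter p : form P R := Atom (exist _ (val p) (letter_in p)).
Definition Adq r : form P R := Atom (exist _ (val r) (reason_in r)).

Lemma Letter_Adq p r : val p = val r -> Letter p = Adq r.
Proof. by move=> e; congr Atom; exact: val_inj. Qed.

Definition And phi psi := Neg (Or (Neg phi) (Neg psi)).
Definition Imp phi psi := Or (Neg phi) psi.
Definition Iff phi psi := And (Imp phi psi) (Imp psi phi).

End Syntax.

Inductive scheme : Type :=
| SVar of nat
| SNeg of scheme
| SOr of scheme & scheme.

Fixpoint seval (v : nat -> bool) (s : scheme) : bool :=
  match s with
  | SVar i => v i
  | SNeg s1 => ~~ seval v s1
  | SOr s1 s2 => seval v s1 || seval v s2
  end.

Definition tautology (s : scheme) : Prop := forall v, seval v s.

Fixpoint sinst (Sym : Type) (P R : set Sym) (f : nat -> form P R)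
    (s : scheme) : form P R :=
  match s with
  | SVar i => f i
  | SNeg s1 => Neg (sinst f s1)
  | SOr s1 s2 => Or (sinst f s1) (sinst f s2)
  end.

Inductive RBB (Sym : Type) (P R : set Sym) : form P R -> Prop :=
| RBB_CL (s : scheme) (f : nat -> form P R) :
    tautology s -> RBB (sinst f s)
| RBB_RK (r : R) (phi psi : form P R) :
    RBB (Imp (Rea r (Imp phi psi)) (Imp (Rea r phi) (Rea r psi)))
| RBB_A (r : R) (phi : form P R) :
    RBB (Imp (Rea r phi) (Imp (Adq r) phi))
| RBB_RB (r : R) (phi : form P R) :
    RBB (Imp (Rea r phi) (Imp (Bel (Adq r)) (Bel phi)))
| RBB_D (phi : form P R) :
    RBB (Imp (Bel phi) (Neg (Bel (Neg phi))))
| RBB_MP (phi psi : form P R) :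
    RBB (Imp phi psi) -> RBB phi -> RBB psi
| RBB_RN (r : R) (phi : form P R) :
    RBB phi -> RBB (Rea r phi)
| RBB_E (phi psi : form P R) :
    RBB (Iff phi psi) -> RBB (Iff (Bel phi) (Bel psi)).

Definition succs (W : Type) (A : set (W * W)) (w : W) : set W :=
  [set v | A (w, v)].

Definition loops (W : Type) (A : set (W * W)) : set W :=
  [set v | A (v, v)].

Record model (Sym : Type) (P R : set Sym) : Type := Model {
  world : Type;
  access : R -> set (world * world);
  nbh : world -> set (set world);
  vals : world -> set P;
  world_nonempty : inhabited world;
  model_pr : forall (p : P) (r : R) (w : world), val p = val r ->
    (vals w p <-> succs (access r) w w);
  model_d : forall (w : world) (X : set world), nbh w X -> ~ nbh w (~` X);
  model_rb : forall (w : world) (r : R) (X : set world),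
    succs (access r) w `<=` X -> nbh w (loops (access r)) -> nbh w X
}.

(* In the [Atom] clause a symbol is evaluated by the valuation if it lies in
   [P] and by the accessibility relation if it lies in [R]; by [model_pr] the
   two agree on [P `&` R], which gives [sat_Letter] and [sat_Adq] below. *)
Fixpoint sat (Sym : Type) (P R : set Sym) (M : model P R)
    (w : world M) (phi : form P R) {struct phi} : Prop :=
  match phi with
  | Atom x => (exists2 p : P, val p = val x & vals w p) \/
              (exists2 r : R, val r = val x & succs (access r) w w)
  | Neg psi => ~ sat w psi
  | Or psi chi => sat w psi \/ sat w chi
  | Rea r psi => succs (access r) w `<=` [set v | sat v psi]
  | Bel psi => nbh w [set v | sat v psi]
  end.

Definition truth_set (Sym : Type) (P R : set Sym) (M : model P R)
    (phi : form P R) : set (world M) := [set v | sat v phi].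
Arguments truth_set {Sym P R} M phi.

Definition valid (Sym : Type) (P R : set Sym) (phi : form P R) : Prop :=
  forall M : model P R, truth_set M phi = setT.

Lemma sat_Letter (Sym : Type) (P R : set Sym) (M : model P R) (w : world M)
  (p : P) : sat w (Letter p : form P R) <-> vals w p.
Proof.
split=> [[[q /val_inj -> //]|[r e]]|wp]; last by left; exists p.
by have [_ pr] := model_pr w (esym e).
Qed.

Lemma sat_Adq (Sym : Type) (P R : set Sym) (M : model P R) (w : world M)
  (r : R) : sat w (Adq r : form P R) <-> succs (access r) w w.
Proof.
split=> [[[p e]|[q /val_inj -> //]]|wr]; last by right; exists r.
by have [pr _] := model_pr w e.
Qed.

(* Main.v *)
Require Import Defs.
From mathcomp Require Import all_boot.
From mathcomp Require Import boolp classical_sets.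

Set Implicit Arguments.
Unset Strict Implicit.
Unset Printing Implicit Defensive.

Local Open Scope classical_set_scope.

(* Completeness is by a canonical model whose worlds are two copies of each
   maximal consistent set.  The usual canonical relation for [r] may relate a
   set [w] to itself although the formula [r] is not in [w]; those loops are
   deleted, and the second copy of [w] keeps the information they carried.  The
   neighbourhoods of [w] are the truth sets of the formulas believed at [w],
   together with all supersets of the successors of [w] under a reason that is
   believed adequate.  Condition (d) holds because two reasons believed
   adequate at [w] have a common successor: otherwise one of them supports some
   formula and the other its negation, against (RB) and (D). *)

(** * Derivation from hypotheses and Lindenbaum's lemma *)

Section Lindenbaum.
Context {Sym : Type} {P R : set Sym}.
Implicit Types (r : R) (phi psi chi : form P R) (G w : set (form P R)).

(** The rules (RN) and (E) are available only inside [RBB], never under hypotheses, so the deduction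
    theorem holds. *)
Inductive der G : form P R -> Prop :=
| der_thm phi of RBB phi : der G phi
| der_hyp phi of G phi : der G phi
| der_mp phi psi of der G (Imp phi psi) & der G phi : der G psi.

Lemma RBB_taut (s : scheme) phi psi chi :
  tautology s -> RBB (sinst (nth phi [:: phi; psi; chi]) s).
Proof. exact: RBB_CL. Qed.

Let SImp s1 s2 := SOr (SNeg s1) s2.
Let X := SVar 0.
Let Y := SVar 1.
Let Z := SVar 2.

Ltac tautology_by s a b c :=
  let v := fresh in
  by apply: (@RBB_taut s a b c) => v /=; case: (v 0); case: (v 1); case: (v 2).

Lemma RBB_weaken phi psi : RBB (Imp phi (Imp psi phi)).
Proof. tautology_by (SImp X (SImp Y X)) phi psi phi. Qed.

Lemma RBB_distr phi psi chi :
  RBB (Imp (Imp phi (Imp psi chi)) (Imp (Imp phi psi) (Imp phi chi))).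
Proof.
tautology_by (SImp (SImp X (SImp Y Z)) (SImp (SImp X Y) (SImp X Z)))
  phi psi chi.
Qed.

Lemma RBB_refl phi : RBB (Imp phi phi).
Proof. tautology_by (SImp X X) phi phi phi. Qed.

Lemma RBB_absurd phi psi : RBB (Imp phi (Imp (Neg phi) psi)).
Proof. tautology_by (SImp X (SImp (SNeg X) Y)) phi psi phi. Qed.

Lemma RBB_cases phi psi :
  RBB (Imp (Imp phi psi) (Imp (Imp (Neg phi) psi) psi)).
Proof.
tautology_by (SImp (SImp X Y) (SImp (SImp (SNeg X) Y) Y)) phi psi phi.
Qed.

Lemma RBB_orl phi psi : RBB (Imp phi (Or phi psi)).
Proof. tautology_by (SImp X (SOr X Y)) phi psi phi. Qed.

Lemma RBB_orr phi psi : RBB (Imp psi (Or phi psi)).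
Proof. tautology_by (SImp Y (SOr X Y)) phi psi phi. Qed.

Lemma RBB_or_neg phi psi : RBB (Imp (Or phi psi) (Imp (Neg phi) psi)).
Proof. tautology_by (SImp (SOr X Y) (SImp (SNeg X) Y)) phi psi phi. Qed.

Lemma der_imp G phi psi : RBB (Imp phi psi) -> der G phi -> der G psi.
Proof. by move=> h; apply: der_mp; apply: der_thm. Qed.

Lemma der_imp2 G phi psi chi :
  RBB (Imp phi (Imp psi chi)) -> der G phi -> der G psi -> der G chi.
Proof. by move=> h /(der_imp h); apply: der_mp. Qed.

Lemma deduction G phi psi : der (phi |` G) psi -> der G (Imp phi psi).
Proof.
elim=> {psi} [psi h|psi [->|h]|psi chi _ h1 _ h2].
- by apply: (der_imp (RBB_weaken _ _)); apply: der_thm.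
- by apply: der_thm; apply: RBB_refl.
- by apply: (der_imp (RBB_weaken _ _)); apply: der_hyp.
- exact: (der_imp2 (RBB_distr _ _ _) h1 h2).
Qed.

Lemma der_sub G H phi : G `<=` H -> der G phi -> der H phi.
Proof.
move=> GH; elim=> {phi} [phi|phi /GH|phi psi _ h1 _ h2].
- exact: der_thm.
- exact: der_hyp.
- exact: der_mp h1 h2.
Qed.

Lemma der_set0 phi : der set0 phi -> RBB phi.
Proof. by elim=> {phi} // phi psi _ h1 _ h2; apply: RBB_MP h1 h2. Qed.

(** A derivation uses finitely many hypotheses, so those taken from a chain lie in a single member.
    The first alternative covers the empty chain. *)
Lemma der_chain G (F : set (set (form P R))) phi :
  total_on F subset -> der (G `|` \bigcup_(A in F) A) phi ->
  der G phi \/ exists2 A, F A & der (G `|` A) phi.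
Proof.
move=> Ftot; elim=> {phi} [phi h|phi [h|[A FA h]]|phi psi _ IH1 _ IH2].
- by left; apply: der_thm.
- by left; apply: der_hyp.
- by right; exists A => //; apply: der_hyp; right.
case: IH1 => [h1|[A FA h1]]; case: IH2 => [h2|[B FB h2]].
- by left; apply: der_mp h1 h2.
- right; exists B => //; apply: der_mp h2.
  by apply: der_sub h1; left.
- right; exists A => //; apply: (der_mp h1).
  by apply: der_sub h2; left.
- case: (Ftot A B FA FB) => AB.
  + right; exists B => //; apply: der_mp h2.
    by apply: der_sub h1; apply: setUS.
  + right; exists A => //; apply: (der_mp h1).
    by apply: der_sub h2; apply: setUS.
Qed.

Definition mcs w : Prop :=
  (forall phi, der w phi -> w phi) /\ (forall phi, w (Neg phi) <-> ~ w phi).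

Lemma lindenbaum G chi :
  ~ der G chi -> exists w, [/\ mcs w, G `<=` w & ~ w chi].
Proof.
move=> nG.
have [A [nA maxA]] : exists A, ~ der (G `|` A) chi /\
    forall B, A `<` B -> ~ ~ der (G `|` B) chi.
  (* Zorn's lemma is applied to the sets added to [G], so that the empty chain is settled by
     [nG]. *)
  apply: (@Zorn_bigcup _ [set A | ~ der (G `|` A) chi]) => F FP Ftot.
  by move=> /(der_chain Ftot) [//|[A /FP]].
(* By maximality, adding a missing formula makes [chi] derivable. *)
have out phi : ~ (G `|` A) phi -> der (G `|` A) (Imp phi chi).
  move=> nphi; apply: deduction; apply: contrapT => nder.
  apply: (maxA (phi |` A)) => [|h].
    split=> [psi ?|sub]; first by right.
    by apply: nphi; right; apply: sub; left.
  apply: nder; apply: der_sub h => psi.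
  by move=> [|[]]; [right; left|left|right; right].
have closed phi : der (G `|` A) phi -> (G `|` A) phi.
  by move=> h; apply: contrapT => /out h'; apply: nA; apply: der_mp h' h.
exists (G `|` A); split; [split=> // phi; split|by left|].
- move=> /der_hyp hN /der_hyp h; apply: nA.
  exact: der_imp2 (RBB_absurd _ _) h hN.
- move=> /out h; apply: contrapT => /out hN; apply: nA.
  exact: der_imp2 (RBB_cases _ _) h hN.
- by move=> /der_hyp.
Qed.

(** This reduces provability to membership, so later propositional theorems need no explicit
    scheme. *)
Lemma RBB_mcs phi : (forall w, mcs w -> w phi) -> RBB phi.
Proof.
move=> h; apply: contrapT => nphi.
have [|w [/h hw _ //]] := @lindenbaum set0 phi.
by move=> /der_set0.
Qed.

(** * Connectives in maximal consistent sets *)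

Section Mcs.
Variables (w : set (form P R)) (wmcs : mcs w).

Lemma mcs_thm phi : RBB phi -> w phi.
Proof. by move=> h; apply: wmcs.1; apply: der_thm. Qed.

Lemma mcs_mp phi psi : w (Imp phi psi) -> w phi -> w psi.
Proof.
by move=> h1 h2; apply: wmcs.1; apply: der_mp (der_hyp h1) (der_hyp h2).
Qed.

Lemma mcs_neg phi : w (Neg phi) <-> ~ w phi.
Proof. exact: wmcs.2. Qed.

Lemma mcs_or phi psi : w (Or phi psi) <-> w phi \/ w psi.
Proof.
split=> [h|[]]; last 2 first.
- by apply: mcs_mp; apply: mcs_thm; apply: RBB_orl.
- by apply: mcs_mp; apply: mcs_thm; apply: RBB_orr.
have [|/mcs_neg n] := pselect (w phi); first by left.
right; apply: mcs_mp n; apply: mcs_mp h.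
by apply: mcs_thm; apply: RBB_or_neg.
Qed.

Lemma mcs_imp phi psi : w (Imp phi psi) <-> (w phi -> w psi).
Proof.
rewrite /Imp mcs_or mcs_neg; split=> [[//|//]|h].
by have [/h|] := pselect (w phi); [right|left].
Qed.

Lemma mcs_and phi psi : w (And phi psi) <-> w phi /\ w psi.
Proof.
rewrite /And mcs_neg mcs_or !mcs_neg; split=> [h|[? ?] []//].
by split; apply: contrapT => ?; apply: h; [left|right].
Qed.

Lemma mcs_iff phi psi : w (Iff phi psi) <-> (w phi <-> w psi).
Proof. by rewrite /Iff mcs_and !mcs_imp. Qed.

End Mcs.

(** * Formulas supported by a reason *)

Definition supported w r : set (form P R) := [set phi | w (Rea r phi)].

Section Supported.
Variables (w : set (form P R)) (wmcs : mcs w).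
Local Notation supported := (supported w).

Lemma supported_thm r phi : RBB phi -> supported r phi.
Proof. by move=> h; apply: (mcs_thm wmcs); apply: RBB_RN. Qed.

Lemma supported_mp r phi psi :
  supported r (Imp phi psi) -> supported r phi -> supported r psi.
Proof.
move=> h; apply: (mcs_mp wmcs); apply: (mcs_mp wmcs) h.
by apply: (mcs_thm wmcs); apply: RBB_RK.
Qed.

Lemma supported_der r phi : der (supported r) phi -> supported r phi.
Proof.
elim=> {phi} // [phi|phi psi _ h1 _ h2]; first exact: supported_thm.
exact: supported_mp h1 h2.
Qed.

Lemma supported_witness r phi : ~ w (Rea r phi) ->
  exists v, [/\ mcs v, supported r `<=` v & ~ v phi].
Proof. by move=> n; apply: lindenbaum => /supported_der. Qed.

Lemma mcs_rb r phi : w (Rea r phi) -> w (Bel (Adq r)) -> w (Bel phi).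
Proof.
move=> h; apply: (mcs_mp wmcs); apply: (mcs_mp wmcs) h.
by apply: (mcs_thm wmcs); apply: RBB_RB.
Qed.

Lemma mcs_d phi : w (Bel phi) -> ~ w (Bel (Neg phi)).
Proof.
move=> h; apply/(mcs_neg wmcs); apply: (mcs_mp wmcs) h.
by apply: (mcs_thm wmcs); apply: RBB_D.
Qed.

(** Induction on the derivation separates the contribution of [r] from that of [s]: a hypothesis
    from [r] is its own interpolant, one from [s] takes a tautology, and modus ponens takes the
    conjunction of the two interpolants. *)
Lemma supported_interpolant r s chi : der (supported r `|` supported s) chi ->
  exists2 phi, supported r phi & supported s (Imp phi chi).
Proof.
elim=> {chi} [chi h|chi [h|h]|phi psi _ [a ra sa] _ [b rb sb]].
- exists chi; first exact: supported_thm.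
  by apply: supported_thm; apply: RBB_refl.
- by exists chi => //; apply: supported_thm; apply: RBB_refl.
- exists (Imp chi chi); first by apply: supported_thm; apply: RBB_refl.
  by apply: supported_mp h; apply: supported_thm; apply: RBB_weaken.
- exists (And a b).
    apply: supported_mp rb; apply: supported_mp ra; apply: supported_thm.
    by apply: RBB_mcs => v vm; rewrite !(mcs_imp vm) mcs_and.
  apply: supported_mp sb; apply: supported_mp sa; apply: supported_thm.
  apply: RBB_mcs => v vm; rewrite !(mcs_imp vm) mcs_and //.
  by move=> h1 h2 [/h1 h3 /h2].
Qed.

(** If the union were inconsistent, an interpolant [phi] would be supported by [r] and its negation
    by [s]. Then (RB) makes both believed, against (D). *)
Lemma common_successor r s : w (Bel (Adq r)) -> w (Bel (Adq s)) ->
  exists v, [/\ mcs v, supported r `<=` v & supported s `<=` v].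
Proof.
move=> Br Bs; pose bot : form P R := Neg (Imp (Adq r) (Adq r)).
have [|v [vm sub _]] := @lindenbaum (supported r `|` supported s) bot.
  move=> /supported_interpolant [phi rphi sphi].
  apply: (@mcs_d phi); first exact: mcs_rb rphi Br.
  apply: mcs_rb Bs; apply: supported_mp sphi; apply: supported_thm.
  apply: RBB_mcs => v vm; rewrite !(mcs_imp vm) !(mcs_neg vm) (mcs_imp vm).
  by move=> h /h; apply.
by exists v; split=> // phi h; apply: sub; [left|right].
Qed.

End Supported.
End Lindenbaum.

(** * Canonical model and completeness *)

Section Canonical.
Context {Sym : Type} {P R : set Sym}.
Implicit Types (r : R) (phi psi : form P R).

Definition cworld : Type := {w : set (form P R) | mcs w} * bool.
Implicit Types (x y : cworld) (X : set cworld).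

Definition theory x : set (form P R) := sval x.1.

Lemma theory_mcs x : mcs (theory x).
Proof. exact: svalP x.1. Qed.

(** The second condition compares worlds, not theories, so an edge to the other copy of the same
    theory survives. *)
Definition caccess r : set (cworld * cworld) :=
  [set xy | supported (theory xy.1) r `<=` theory xy.2 /\
            (xy.1 = xy.2 -> theory xy.1 (Adq r))].

Definition cext phi : set cworld := [set x | theory x phi].

Definition cnbh x : set (set cworld) :=
  [set X | (exists2 phi, X = cext phi & theory x (Bel phi)) \/
           (exists2 r, theory x (Bel (Adq r)) & succs (caccess r) x `<=` X)].

Definition cvals x : set P := [set p | theory x (Letter p)].

Lemma caccess_loop r x : succs (caccess r) x x <-> theory x (Adq r).
Proof.
split=> [[_]|h]; first exact.
split=> // phi hr; have xm := theory_mcs x.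
apply: (mcs_mp xm) h; apply: (mcs_mp xm) hr.
by apply: mcs_thm => //; apply: RBB_A.
Qed.

(* Passing to the other copy makes sure that the successor is not a loop. *)
Lemma caccess_other_copy x v (vm : mcs v) r : supported (theory x) r `<=` v ->
  succs (caccess r) x (exist _ v vm, ~~ x.2).
Proof. by move=> sub; split=> //= e; move: (congr1 snd e) => /=; case: x.2. Qed.

(** If [Rea r phi] fails, some maximal consistent set contains all that [r] supports but not [phi];
    its copy with the flag opposite to that of [x] is a successor. *)
Lemma succs_cext r x phi :
  succs (caccess r) x `<=` cext phi <-> theory x (Rea r phi).
Proof.
split=> [sub|h y [ry _]]; last exact: ry.
apply: contrapT => /(supported_witness (theory_mcs x)) [v [vm rv]]; apply.
exact: sub (caccess_other_copy vm rv).
Qed.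

Lemma cext_neg phi : ~` cext phi = cext (Neg phi).
Proof.
by apply/seteqP; split=> x /=; rewrite /cext /= (mcs_neg (theory_mcs x)).
Qed.

(** Formulas with equal extensions lie in the same maximal consistent sets, hence are provably
    equivalent, and (E) applies. *)
Lemma cext_Bel phi psi x :
  cext phi = cext psi -> theory x (Bel phi) -> theory x (Bel psi).
Proof.
move=> e; suff: theory x (Iff (Bel phi) (Bel psi)).
  by rewrite (mcs_iff (theory_mcs x)) => -[].
apply: (mcs_thm (theory_mcs x)); apply: RBB_E.
apply: RBB_mcs => w wm; apply/(mcs_iff wm).
pose y : cworld := (exist _ w wm, true).
by change (cext phi y <-> cext psi y); rewrite e.
Qed.

(** The neighbourhoods that come from reasons create no new belief, by (RB). *)
Lemma cnbh_cext x phi : cnbh x (cext phi) <-> theory x (Bel phi).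
Proof.
split=> [[[psi e]|[r Br /succs_cext h]]|]; last by left; exists phi.
- exact: cext_Bel.
- exact: mcs_rb (theory_mcs x) _ _ h Br.
Qed.

Lemma caccess_loops r : loops (caccess r) = cext (Adq r).
Proof. by apply/seteqP; split=> x /caccess_loop. Qed.

Lemma canonical_pr (p : P) r x : val p = val r ->
  (cvals x p <-> succs (caccess r) x x).
Proof. by move=> /Letter_Adq e; rewrite caccess_loop /cvals /= e. Qed.

Lemma canonical_d x X : cnbh x X -> ~ cnbh x (~` X).
Proof.
have xm := theory_mcs x.
move=> [[phi -> Bphi]|[r Br rX]].
  by rewrite cext_neg cnbh_cext; apply: mcs_d.
move=> [[psi e Bpsi]|[s Bs sX]].
  (* In the mixed case [X] is itself the extension of a formula, which is therefore believed. *)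
  have eX : X = cext (Neg psi) by rewrite -cext_neg -e setCK.
  have : theory x (Bel (Neg psi)).
    by apply/cnbh_cext; right; exists r; rewrite -?eX.
  exact: mcs_d.
(* The opposite copy of a common successor would lie both in [X] and in its complement. *)
have [v [vm rv sv]] := common_successor xm Br Bs.
exact: (sX _ (caccess_other_copy vm sv))
       (rX _ (caccess_other_copy vm rv)).
Qed.

Lemma canonical_rb x r X :
  succs (caccess r) x `<=` X -> cnbh x (loops (caccess r)) -> cnbh x X.
Proof.
by move=> rX; rewrite caccess_loops cnbh_cext => Br; right; exists r.
Qed.

Definition canonical (ne : inhabited cworld) : model P R :=
  Model ne canonical_pr canonical_d canonical_rb.

Lemma truth_lemma ne phi : truth_set (canonical ne) phi = cext phi.
Proof.
suff sat_theory (x : world (canonical ne)) : sat x phi <-> theory x phi.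
  by apply/seteqP; split=> x /sat_theory.
elim: phi x => [a|phi IH|phi IH1 psi IH2|r phi IH|phi IH] x /=;
  have xm := theory_mcs x.
- split=> [[[p e]|[r e /caccess_loop]]|].
  + by rewrite /cvals /= /Letter; congr (theory x (Atom _)); apply: val_inj.
  + by congr (theory x (Atom _)); apply: val_inj.
  (* The symbol is repackaged as a letter or as a reason; [val_inj] identifies atoms that differ
     only in the membership proof. *)
  + move=> xa; case: (set_mem (valP a)) => /mem_set aS; [left|right].
      exists (exist _ (val a) aS) => //; move: xa.
      by rewrite /cvals /= /Letter; congr (theory x (Atom _)); apply: val_inj.
    exists (exist _ (val a) aS) => //; apply/caccess_loop; move: xa.
    by congr (theory x (Atom _)); apply: val_inj.
- by rewrite IH mcs_neg.
- by rewrite IH1 IH2 mcs_or.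
- rewrite -succs_cext.
  suff -> : [set v : world (canonical ne) | sat v phi] = cext phi by [].
  by apply/seteqP; split=> y /IH.
- rewrite -cnbh_cext.
  suff -> : [set v : world (canonical ne) | sat v phi] = cext phi by [].
  by apply/seteqP; split=> y /IH.
Qed.

Lemma completeness phi : valid phi -> RBB phi.
Proof.
move=> phi_valid; apply: RBB_mcs => w wm.
pose x : cworld := (exist _ w wm, true).
have := phi_valid (canonical (inhabits x)); rewrite truth_lemma => e.
by change (cext phi x); rewrite e.
Qed.

End Canonical.

(** * Soundness *)

Section Soundness.
Context {Sym : Type} {P R : set Sym}.
Implicit Types (r : R) (phi psi : form P R).

Lemma sat_Imp (M : model P R) (x : world M) phi psi :
  sat x (Imp phi psi) <-> (sat x phi -> sat x psi).
Proof.
split=> /= [[//|//]|h].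
by have [/h|] := pselect (sat x phi); [right|left].
Qed.

Lemma sat_Iff (M : model P R) (x : world M) phi psi :
  sat x (Iff phi psi) <-> (sat x phi <-> sat x psi).
Proof.
rewrite /Iff /And /=; split=> [h|[h1 h2] [|]]; last 2 first.
- by case; apply/sat_Imp.
- by case; apply/sat_Imp.
by split; apply/sat_Imp; apply: contrapT => n; apply: h; [left|right].
Qed.

(** Satisfaction at a fixed world, made boolean, is a propositional valuation. *)
Lemma sat_sinst (M : model P R) (x : world M) f s :
  sat x (sinst f s) <-> seval (fun i => `[< sat x (f i) >]) s.
Proof.
elim: s => [i|s IH|s1 IH1 s2 IH2] /=.
- by split=> /asboolP.
- by rewrite IH; split=> /negP.
- by rewrite IH1 IH2; split=> /orP.
Qed.

Lemma soundness phi : RBB phi -> valid phi.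
Proof.
(* The world stays general in the induction, since (RN) and (E) use the hypothesis at all worlds. *)
move=> d M; apply/seteqP; split=> // + _; rewrite /truth_set /=.
elim: d => {phi} [s f st|r phi psi|r phi|r phi|phi|phi psi _ IH1 _ IH2|
  r phi _ IH|phi psi _ IH] x.
- exact/sat_sinst/st.
- rewrite !sat_Imp => h1 h2 y ry.
  by move: (h1 y ry) => /sat_Imp; apply; apply: h2.
- by rewrite !sat_Imp sat_Adq => h; apply: h.
- rewrite !sat_Imp => h Br; apply: (model_rb h).
  suff <- : truth_set M (Adq r) = loops (access r) by [].
  by apply/seteqP; split=> v /sat_Adq.
- rewrite sat_Imp => h; exact: (model_d h).
- by move: (IH1 x) => /sat_Imp; apply.
- by move=> y _; apply: IH.
- apply/sat_Iff => /=.
  suff -> : [set v | sat v phi] = [set v : world M | sat v psi] by [].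
  by apply/seteqP; split=> v /=; have /sat_Iff [] := IH v.
Qed.

End Soundness.

Theorem mainTheorem1 (Sym : Type) (P R : set Sym)
    (P_nonempty : P !=set0) (R_nonempty : R !=set0) (phi : form P R) :
  RBB phi <-> valid phi.
Proof. by split; [apply: soundness | apply: completeness]. Qed.
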